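(* Let $\Gamma\subset\mathbb{R}^d$ be a free $\mathcal{S}$-module of rank $d$ that spans $\mathbb{R}^d$. The map $$\eta\colon\operatorname{OS}(\Gamma)\longrightarrow\mathbb{R}^\bullet/K^\bullet,\qquad R\longmapsto\operatorname{scal}_\Gamma(R),$$ is a group homomorphism with $\operatorname{Ker}(\eta)=\operatorname{OC}(\Gamma)$.
   Context: $\mathcal{S}\subset\mathbb{R}$ is a ring with unity (a subring of $\mathbb{R}$ containing $1$) that is also a finitely generated $\mathbb{Z}$-module; $K\subset\mathbb{R}$ is the field of fractions of $\mathcal{S}$. A free $\mathcal{S}$-module $\Gamma\subset\mathbb{R}^d$ of rank $d$ that spans $\mathbb{R}^d$ is the $\mathcal{S}$-span of an $\mathbb{R}$-basis of $\mathbb{R}^d$; it is a free $\mathbb{Z}$-module of finite rank. Two free $\mathbb{Z}$-modules $M,M'\subset\mathbb{R}^d$ of finite rank are commensurate, written $M\sim M'$, if $M\cap M'$ has finite index both in $M$ and in $M'$. $\operatorname{OC}(\Gamma)=\{R\in\operatorname{O}(d,\mathbb{R}):R\Gamma\sim\Gamma\}$ and $\operatorname{OS}(\Gamma)=\{R\in\operatorname{O}(d,\mathbb{R}):\alpha R\Gamma\sim\Gamma\text{ for some real }\alpha>0\}$; these are subgroups of $\operatorname{O}(d,\mathbb{R})$. For $R\in\operatorname{O}(d,\mathbb{R})$, $\operatorname{scal}_\Gamma(R)=\{\alpha\in\mathbb{R}:\Gamma\sim\alpha R\Gamma\}$. $\mathbb{R}^\bullet$ and $K^\bullet$ are the multiplicative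 groups of nonzero elements of $\mathbb{R}$ and $K$. For $R\in\operatorname{OS}(\Gamma)$ the set $\operatorname{scal}_\Gamma(R)$ is nonempty and equals the coset $\alpha K^\bullet$ for any $\alpha\in\operatorname{scal}_\Gamma(R)$, so it is an element of $\mathbb{R}^\bullet/K^\bullet$ and $\eta$ is well defined. *)

(* Defs.v *)
From HB Require Import structures.
From mathcomp Require Import all_boot all_order all_algebra.
From mathcomp Require Import all_classical all_reals.

Set Implicit Arguments.
Unset Strict Implicit.
Unset Printing Implicit Defensive.

Import Order.TTheory GRing.Theory Num.Theory.

Local Open Scope classical_set_scope.
Local Open Scope ring_scope.

Section Commensurability.
Variable V : zmodType.
Implicit Types M N L : set V.

Definition additive_subgroup M : Prop :=
  M 0 /\ forall x y, M x -> M y -> M (x - y).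

(* The cosets x + N with x in M are finitely many. *)
Definition finite_index N M : Prop :=
  finite_set [set [set x + n | n in N] | x in M].

Definition commensurate M M' : Prop :=
  finite_index (M `&` M') M /\ finite_index (M `&` M') M'.

(* For a subgroup N, finite_index N M amounts to a map with finitely many
   values on M that separates the elements of M modulo N. *)
Let separated N M := exists (T : Type) (f : V -> T),
  finite_set (f @` M) /\ forall x y, M x -> M y -> f x = f y -> N (x - y).

Let finite_indexP N M :
  additive_subgroup N -> finite_index N M <-> separated N M.
Proof.
move=> [N0 NB]; split=> [fin|[T [f [fin sep]]]].
  exists (set V), (fun x => [set x + n | n in N]); split=> // x y _ _ E.
  have : [set x + n | n in N] x by exists 0; rewrite ?addr0.
  by rewrite E => -[n Nn <-]; rewrite addrC addKr.
pose g t := [set xget 0 [set x | M x /\ f x = t] + n | n in N].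
apply: (sub_finite_set _ (finite_image g fin)) => _ [x Mx <-].
exists (f x); first by exists x.
rewrite /g; set r := xget _ _.
have [Mr fr] : M r /\ f r = f x.
  by have := @xgetI V 0 [set z | M z /\ f z = f x] x (conj Mx erefl).
have Nxr : N (x - r) by apply: sep.
have Nrx : N (r - x) by apply: sep.
apply/seteqP; split=> _ [n Nn <-].
  by exists (n - (x - r)); [exact: NB | rewrite opprB addrC -addrA subrK addrC].
by exists (n - (r - x)); [exact: NB | rewrite opprB addrC -addrA subrK addrC].
Qed.

Let separated_trans N L M : L `<=` N -> N `<=` M ->
  separated N M -> separated L N -> separated L M.
Proof.
move=> LN NM [T [f [ffin fsep]]] [U [g [gfin gsep]]].
pose r t := xget 0 [set x | M x /\ f x = t].
have rP x : M x -> M (r (f x)) /\ f (r (f x)) = f x.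
  by move=> Mx; have := @xgetI V 0 [set z | M z /\ f z = f x] x (conj Mx erefl).
have Nr x : M x -> N (x - r (f x)).
  by move=> Mx; have [? ?] := rP x Mx; apply: fsep.
exists (T * U)%type, (fun x => (f x, g (x - r (f x)))); split.
  apply: (sub_finite_set _ (finite_setX ffin gfin)) => _ [x Mx <-].
  split=> /=; first by exists x.
  by exists (x - r (f x)) => //; apply: Nr.
move=> x y Mx My [Ef Eg].
have -> : x - y = (x - r (f x)) - (y - r (f y)).
  by rewrite Ef opprB addrA subrK.
by apply: gsep => //; apply: Nr.
Qed.

Let separated_setI N M L : additive_subgroup L ->
  separated N M -> separated (N `&` L) (M `&` L).
Proof.
move=> [_ LB] [T [f [fin sep]]]; exists T, f; split.
  by apply: sub_finite_set fin; apply: image_subset => x [].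
by move=> x y [Mx Lx] [My Ly] E; split; [apply: sep | apply: LB].
Qed.

Let separated_sub N N' M : N `<=` N' -> separated N M -> separated N' M.
Proof.
move=> NN' [T [f [fin sep]]]; exists T, f; split=> // x y Mx My E.
exact/NN'/sep.
Qed.

Lemma additive_subgroupI M N :
  additive_subgroup M -> additive_subgroup N -> additive_subgroup (M `&` N).
Proof.
move=> [M0 MB] [N0 NB]; split=> // x y [Mx Nx] [My Ny].
by split; [apply: MB | apply: NB].
Qed.

Lemma commensurate_refl M : additive_subgroup M -> commensurate M M.
Proof.
move=> sM; rewrite /commensurate setIid.
suff : finite_index M M by [].
apply/finite_indexP => //; exists unit, (fun=> tt); split.
  by apply: sub_finite_set (finite_set1 tt) => -[].
by move=> x y Mx My _; apply: sM.2.
Qed.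

Lemma commensurate_sym M M' : commensurate M M' -> commensurate M' M.
Proof. by rewrite /commensurate setIC => -[]. Qed.

Lemma commensurate_trans M M' M'' :
    additive_subgroup M -> additive_subgroup M' -> additive_subgroup M'' ->
  commensurate M M' -> commensurate M' M'' -> commensurate M M''.
Proof.
have half A B C : additive_subgroup A -> additive_subgroup B ->
    additive_subgroup C -> finite_index (A `&` B) A ->
    finite_index (B `&` C) B -> finite_index (A `&` C) A.
  move=> sA sB sC.
  have sAB := additive_subgroupI sA sB.
  have sBC := additive_subgroupI sB sC.
  have sAC := additive_subgroupI sA sC.
  move=> /(finite_indexP _ sAB) AB /(finite_indexP _ sBC) BC.
  apply/(finite_indexP _ sAC).
  apply: (@separated_sub (B `&` C `&` A)); first by move=> x [[]].
  apply: separated_trans AB _; [by move=> x [[]] | by move=> x [] |].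
  by rewrite (setIC A B); apply: separated_setI.
move=> sM sM' sM'' [MM' M'M] [M'M'' M''M']; split.
  exact: half MM' M'M''.
rewrite setIC; rewrite setIC in M''M'; rewrite setIC in M'M.
exact: half M''M' M'M.
Qed.

Lemma additive_subgroup_image (f : {additive V -> V}) M :
  additive_subgroup M -> additive_subgroup (f @` M).
Proof.
move=> [M0 MB]; split; first by exists 0; rewrite ?raddf0.
by move=> _ _ [x Mx <-] [y My <-]; exists (x - y); rewrite ?raddfB //; apply: MB.
Qed.

Lemma commensurate_image (f : {additive V -> V}) (g : V -> V) M M' :
    cancel f g -> additive_subgroup M -> additive_subgroup M' ->
  commensurate M M' -> commensurate (f @` M) (f @` M').
Proof.
move=> fK sM sM'.
have fI : f @` M `&` f @` M' = f @` (M `&` M').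
  apply/seteqP; split=> [_ [[x Mx <-] [y My /(can_inj fK) E]]|_ [x [? ?] <-]].
    by exists x => //; rewrite -E in Mx *; split=> //; rewrite -E.
  by split; exists x.
have sI := additive_subgroupI sM sM'.
have sfI := additive_subgroup_image f sI.
have half A : finite_index (M `&` M') A ->
    finite_index (f @` (M `&` M')) (f @` A).
  move=> /(finite_indexP _ sI) [T [h [fin sep]]].
  apply/(finite_indexP _ sfI); exists T, (h \o g); split.
    apply: sub_finite_set fin => _ [_ [x Ax <-] <-] /=.
    by exists x; rewrite ?fK.
  move=> _ _ [x Ax <-] [y Ay <-] /=; rewrite !fK => E.
  by exists (x - y); [apply: sep | rewrite raddfB].
by rewrite /commensurate fI => -[? ?]; split; apply: half.
Qed.

End Commensurability.

Section OrthogonalGroup.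
Variables (R : realType) (d : nat).

Record orthogonal := Orthogonal {
  ortho_mx :> 'M[R]_d;
  _ : ortho_mx *m ortho_mx^T == 1%:M
}.

HB.instance Definition _ := [isSub for ortho_mx].
HB.instance Definition _ := [Choice of orthogonal by <:].

Fact ortho_mulmxT (A : orthogonal) : A *m A^T = 1%:M.
Proof. exact/eqP/(valP A). Qed.

Fact ortho_mulTmx (A : orthogonal) : A^T *m A = 1%:M.
Proof. exact/mulmx1C/ortho_mulmxT. Qed.

Fact ortho_one_subproof : (1%:M : 'M[R]_d) *m 1%:M^T == 1%:M.
Proof. by rewrite trmx1 mulmx1. Qed.

Fact ortho_inv_subproof (A : orthogonal) : A^T *m (A^T)^T == 1%:M.
Proof. by rewrite trmxK ortho_mulTmx. Qed.

Fact ortho_mul_subproof (A B : orthogonal) :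
  (A *m B) *m (A *m B)^T == 1%:M.
Proof. by rewrite trmx_mul mulmxA -(mulmxA A) ortho_mulmxT mulmx1 ortho_mulmxT. Qed.

Definition ortho_one := Orthogonal ortho_one_subproof.
Definition ortho_inv A := Orthogonal (ortho_inv_subproof A).
Definition ortho_mul A B := Orthogonal (ortho_mul_subproof A B).

Fact ortho_mulA : associative ortho_mul.
Proof. by move=> A B C; apply/val_inj/mulmxA. Qed.
Fact ortho_mul1 : left_id ortho_one ortho_mul.
Proof. by move=> A; apply/val_inj/mul1mx. Qed.
Fact ortho_mulr1 : right_id ortho_one ortho_mul.
Proof. by move=> A; apply/val_inj/mulmx1. Qed.
Fact ortho_mulV : left_inverse ortho_one ortho_inv ortho_mul.
Proof. by move=> A; apply/val_inj/ortho_mulTmx. Qed.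
Fact ortho_mulrV : right_inverse ortho_one ortho_inv ortho_mul.
Proof. by move=> A; apply/val_inj/ortho_mulmxT. Qed.

HB.instance Definition _ :=
  isGroup.Build orthogonal ortho_mulA ortho_mul1 ortho_mulr1
    ortho_mulV ortho_mulrV.

End OrthogonalGroup.

Section Quotient.
Variables (R : realType) (S : subringClosed R).

Definition fg_Zmodule : Prop :=
  exists (n : nat) (s : n.-tuple R), forall x, x \in S <-> inIntSpan s x.

Definition frac_field : set R :=
  [set x | exists a b, [/\ a \in S, b \in S, b != 0 & x = a / b]].

Definition frac_units : set R := [set x | frac_field x /\ x != 0].

(* An element of the quotient group of the nonzero reals by the nonzero
   elements of the fraction field is a coset, i.e. a set of reals. *)
Record units_quotient := UnitsQuotient {
  coset_set :> set R;
  uquotP : exists2 a, a != 0 & coset_set = [set a * k | k in frac_units]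
}.

Fact frac_units1 : frac_units 1.
Proof.
by split; [exists 1, 1; rewrite divr1 rpred1 oner_eq0 | rewrite oner_eq0].
Qed.

Fact frac_unitsM x y : frac_units x -> frac_units y -> frac_units (x * y).
Proof.
move=> [[a [b [Sa Sb b0 xE]]] x0] [[c [e [Sc Se e0 yE]]] y0].
split; last exact: mulf_neq0.
by exists (a * c), (b * e); rewrite xE yE mulf_div !rpredM // mulf_neq0.
Qed.

Fact frac_unitsV x : frac_units x -> frac_units x^-1.
Proof.
move=> [[a [b [Sa Sb b0 xE]]] x0]; split; last by rewrite invr_eq0.
exists b, a; rewrite xE invf_div; split=> //.
by apply: contraNneq x0 => a0; rewrite xE a0 mul0r.
Qed.

Fact uquot_inj : injective coset_set.
Proof. by move=> [A hA] [B hB] /= E; subst B; rewrite (Prop_irrelevance hA hB). Qed.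

Fact uquot_one_subproof :
  exists2 a, a != 0 & frac_units = [set a * k | k in frac_units].
Proof.
exists 1; rewrite ?oner_eq0 //; apply/seteqP.
by split=> [x Kx|_ [x Kx <-]]; [exists x; rewrite ?mul1r | rewrite mul1r].
Qed.

Fact uquot_mul_subproof (A B : units_quotient) :
  exists2 a, a != 0 & [set x * y | x in A & y in B] =
                      [set a * k | k in frac_units].
Proof.
have [a a0 ->] := uquotP A; have [b b0 ->] := uquotP B.
exists (a * b); first exact: mulf_neq0.
apply/seteqP; split=> [_ [_ [k Kk <-] [_ [l Kl <-] <-]]|_ [k Kk <-]].
  by exists (k * l); [apply: frac_unitsM | rewrite mulrACA].
exists (a * k); first by exists k.
by exists b; [exists 1; [apply: frac_units1 | rewrite mulr1] | rewrite mulrAC].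
Qed.

Fact uquot_inv_subproof (A : units_quotient) :
  exists2 a, a != 0 & [set x^-1 | x in A] = [set a * k | k in frac_units].
Proof.
have [a a0 ->] := uquotP A; exists a^-1; first by rewrite invr_eq0.
apply/seteqP; split=> [_ [_ [k Kk <-] <-]|_ [k Kk <-]].
  by exists k^-1; [apply: frac_unitsV | rewrite invfM].
exists (a * k^-1); last by rewrite invfM invrK.
by exists k^-1 => //; apply: frac_unitsV.
Qed.

Definition uquot_one := UnitsQuotient uquot_one_subproof.
Definition uquot_mul A B := UnitsQuotient (uquot_mul_subproof A B).
Definition uquot_inv A := UnitsQuotient (uquot_inv_subproof A).

Fact uquot_mulC : commutative uquot_mul.
Proof.
move=> A B; apply: uquot_inj; apply/seteqP.
by split=> _ [x Ax [y By <-]]; exists y => //; exists x => //; rewrite mulrC.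
Qed.

Fact uquot_mulA : associative uquot_mul.
Proof.
move=> A B C; apply: uquot_inj; apply/seteqP; split.
  move=> _ [x Ax [_ [y By [z Cz <-]] <-]].
  exists (x * y); first by exists x => //; exists y.
  by exists z; rewrite ?mulrA.
move=> _ [_ [x Ax [y By <-]] [z Cz <-]].
exists x => //; exists (y * z); last by rewrite mulrA.
by exists y => //; exists z.
Qed.

Fact uquot_mul1 : left_id uquot_one uquot_mul.
Proof.
move=> A; apply: uquot_inj => /=; have [a a0 ->] := uquotP A; apply/seteqP.
split=> [_ [k Kk [_ [l Kl <-] <-]]|_ [k Kk <-]].
  by exists (k * l); [apply: frac_unitsM | rewrite mulrCA].
exists 1; first exact: frac_units1.
by exists (a * k); [exists k | rewrite mul1r].
Qed.

Fact uquot_mulr1 : right_id uquot_one uquot_mul.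
Proof. by move=> A; rewrite uquot_mulC uquot_mul1. Qed.

Fact uquot_mulV : left_inverse uquot_one uquot_inv uquot_mul.
Proof.
move=> A; apply: uquot_inj => /=; have [a a0 ->] := uquotP A; apply/seteqP.
split=> [_ [_ [_ [k Kk <-] <-] [_ [l Kl <-] <-]]|k Kk].
  rewrite invfM mulrACA mulVf // mul1r.
  by apply: frac_unitsM => //; apply: frac_unitsV.
exists (a^-1).
  by exists a => //; exists 1; rewrite ?mulr1 //; apply: frac_units1.
by exists (a * k); [exists k | rewrite mulKf].
Qed.

Fact uquot_mulrV : right_inverse uquot_one uquot_inv uquot_mul.
Proof. by move=> A; rewrite uquot_mulC uquot_mulV. Qed.

HB.instance Definition _ := gen_eqMixin units_quotient.
HB.instance Definition _ := gen_choiceMixin units_quotient.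
HB.instance Definition _ :=
  isGroup.Build units_quotient uquot_mulA uquot_mul1 uquot_mulr1 uquot_mulV uquot_mulrV.

End Quotient.

Section Lattices.
Variables (R : realType) (S : subringClosed R) (d : nat).

Definition is_free_lattice (Gamma : set 'cV[R]_d) : Prop :=
  exists2 b : d.-tuple 'cV[R]_d, basis_of fullv b &
    Gamma = [set \sum_(i < d) c i *: tnth b i | c in
              [set c : 'I_d -> R | forall i, c i \in S]].

Record free_lattice := FreeLattice {
  lattice_set :> set 'cV[R]_d;
  free_latticeP : is_free_lattice lattice_set
}.

Variable Gamma : free_lattice.

Definition scaled_image (a : R) (A : orthogonal R d) : set 'cV[R]_d :=
  [set a *: (A *m v) | v in Gamma].

Definition scal (A : orthogonal R d) : set R :=
  [set a | commensurate Gamma (scaled_image a A)].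

Definition OC : set (orthogonal R d) :=
  [set A | commensurate [set A *m v | v in Gamma] Gamma].

Definition OS : pred (orthogonal R d) := fun A =>
  `[< exists2 a, 0 < a & commensurate (scaled_image a A) Gamma >].

Fact additive_subgroup_lattice : additive_subgroup Gamma.
Proof.
have [b _ ->] := free_latticeP Gamma; split.
  exists (fun=> 0); first by move=> i; apply: rpred0.
  by rewrite big1 // => i _; rewrite scale0r.
move=> _ _ [c Sc <-] [e Se <-]; exists (fun i => c i - e i).
  by move=> i; apply: rpredB.
by rewrite -sumrB; apply: eq_bigr => i _; rewrite scalerBl.
Qed.

Fact OS_group_closed : group_closed OS.
Proof.
have mulE a (A : orthogonal R d) :
    scaled_image a A = mulmx (a *: (A : 'M_d)) @` Gamma.
  by apply: eq_imagel => v _; rewrite scalemxAl.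
have sG := additive_subgroup_lattice.
have sI a A : additive_subgroup (scaled_image a A).
  by rewrite mulE; apply: additive_subgroup_image.
split.
  apply/asboolP; exists 1 => //.
  rewrite mulE (_ : mulmx _ = id) ?image_id; first exact: commensurate_refl.
  by apply: funext => v; rewrite scale1r mul1mx.
move=> A B /asboolP [a a0 hA] /asboolP [b b0 hB]; apply/asboolP.
exists (a / b); first exact: divr_gt0.
apply: (commensurate_trans _ _ _ _ hA) => //.
pose T : 'M[R]_d := (a / b) *: (A *m B^T).
have TK : cancel (mulmx T : 'cV_d -> 'cV_d) (mulmx ((b / a) *: (B *m A^T))).
  move=> v; rewrite mulmxA /T -scalemxAl -scalemxAr scalerA.
  rewrite mulmxA -(mulmxA (B : 'M_d)) ortho_mulTmx mulmx1 ortho_mulmxT.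
  by rewrite mulrA divfK ?divff ?scale1r ?mul1mx // gt_eqF.
rewrite (_ : scaled_image (a / b) _ = mulmx T @` Gamma); last exact: mulE.
rewrite (_ : scaled_image a A = mulmx T @` scaled_image b B).
  exact: (commensurate_image TK sG (sI b B) (commensurate_sym hB)).
have TB : T *m (b *: (B : 'M_d)) = a *: (A : 'M_d).
  rewrite /T -scalemxAl -scalemxAr scalerA divfK ?gt_eqF //.
  by rewrite -mulmxA ortho_mulTmx mulmx1.
by rewrite !mulE image_comp; apply: eq_imagel => v _ /=; rewrite mulmxA TB.
Qed.

Record OSgroup := MkOS { OS_val :> orthogonal R d; _ : OS OS_val }.

HB.instance Definition _ := [isSub for OS_val].
HB.instance Definition _ := [Choice of OSgroup by <:].
HB.instance Definition _ :=
  SubChoice_isSubGroup.Build (orthogonal R d) OS OSgroup OS_group_closed.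

End Lattices.

(* Main.v *)
Require Import Defs.
From HB Require Import structures.
From mathcomp Require Import all_boot all_order all_algebra.
From mathcomp Require Import all_classical all_reals.

(** Why the theorem holds.  Write [G] for the lattice and say that a real [a]
    is admissible for [A] when [G ~ a A G], i.e. [a \in scal G A].  Everything
    reduces to the single computation [scal G 1 = K^*] ([scal_one]), because
    the admissible pairs [(a, A)] form a group: from [G ~ b B G], applying the
    invertible map [a A] and using transitivity gives [G ~ a b A B G]
    ([scal_mul]), and applying the inverse of [a A] to [G ~ a A G] gives
    [scal_inv].  Hence [scal G A], when it contains some [a], is the coset
    [a * scal G 1] ([scal_coset]): cosets multiply as their representatives
    do, so [eta] is a morphism, and [eta A] is trivial exactly when [1] is
    admissible for [A], i.e. when [A G ~ G].

    The computation of [scal G 1] has two halves.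

    - If [G ~ b G], pigeonhole applied to the multiples of a basis vector [v]
      gives [n > 0] with [n v] in [b G] ([finite_index_mulrn]).  Comparing
      coordinates, [n = b c] with [c] in [S], so [b = n / c] is a nonzero
      element of [K].  Here [d > 0] matters: it provides [v].

    - If [p] is a nonzero element of [S], then [p S] contains a nonzero
      integer [N]: since [S] is a finitely generated Z-module, [p] is a root of
      the characteristic polynomial of an integer matrix, and [N] is the lowest
      nonzero coefficient of that polynomial ([fg_int_multiple]).  As
      [S / N S] is finite, so are [S / p S] ([fg_finite_residues]) and
      [G / p G].  Hence [G ~ p G], and fractions follow from the group law. *)

Set Implicit Arguments.
Unset Strict Implicit.
Unset Printing Implicit Defensive.

Import Order.TTheory GRing.Theory Num.Theory.

Local Open Scope classical_set_scope.
Local Open Scope ring_scope.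

(** * Subgroups of finite index *)

Section FiniteIndex.
Variable V : zmodType.
Implicit Types M N : set V.

(** Finiteness of the index is usually certified by a residue map: its values
    bound the number of cosets. *)
Lemma finite_index_residues N M (T : finType) (f : V -> T) :
    additive_subgroup N ->
    (forall x y, M x -> M y -> f x = f y -> N (x - y)) ->
  finite_index N M.
Proof.
move=> [N0 NB] sep; rewrite /finite_index.
pose g t := [set xget 0 [set x | M x /\ f x = t] + n | n in N].
apply: (sub_finite_set _ (finite_image g (@finite_finset T setT))).
move=> _ [x Mx <-]; exists (f x) => //; rewrite /g; set r := xget _ _.
have [Mr fr] : M r /\ f r = f x.
  by have := @xgetI V 0 [set z | M z /\ f z = f x] x (conj Mx erefl).
have Nxr : N (x - r) by apply: sep.
have Nrx : N (r - x) by apply: sep.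
apply/seteqP; split=> _ [n Nn <-].
  by exists (n - (x - r)); [exact: NB | rewrite opprB addrC -addrA subrK addrC].
by exists (n - (r - x)); [exact: NB | rewrite opprB addrC -addrA subrK addrC].
Qed.

(** Pigeonhole: two of the multiples of [x] lie in the same coset. *)
Lemma finite_index_mulrn N M x :
    additive_subgroup M -> additive_subgroup N -> finite_index N M -> M x ->
  exists2 n, (0 < n)%N & N (x *+ n).
Proof.
move=> [M0 MB] [N0 _] fin Mx.
have Mn n : M (x *+ n).
  have MN y : M y -> M (- y) by move=> My; rewrite -sub0r; apply: MB.
  elim: n => [|n IHn]; first by rewrite mulr0n.
  by rewrite mulrS -[x *+ n]opprK; apply: MB => //; apply: MN.
pose f n := [set x *+ n + y | y in N].
apply: contrapT => noN; apply: infinite_nat.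
have -> : [set: nat] = f @^-1` [set [set z + n | n in N] | z in M].
  by apply/seteqP; split=> // n _; exists (x *+ n).
apply: finite_preimage => // m n _ _ /=.
wlog lt_mn : m n / (m < n)%N => [wl|] E.
  by case: (ltngtP m n) => // [/wl|/wl/(_ (esym E))]; [apply|].
have : f n (x *+ n) by exists 0; rewrite ?addr0.
rewrite -E => -[y Ny yE]; case: noN; exists (n - m)%N; rewrite ?subn_gt0 //.
by rewrite mulrnBr 1?ltnW // -yE addrC addKr.
Qed.

End FiniteIndex.

(** * Subrings of the reals that are finitely generated over Z *)

Section FgSubring.
Variables (R : realType) (S : subringClosed R).

(** Dividing a relation [Q(x) = 0] by the largest power of [x] that divides
    [Q] leaves a nonzero constant term, which is then a multiple of [x]. *)
Lemma int_multiple_of_root (Q : {poly int}) (x : R) :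
    Q != 0 -> x \in S -> x != 0 -> root (map_poly intr Q) x ->
  exists N : int, exists2 t, t \in S & N != 0 /\ N%:~R = x * t.
Proof.
move=> + Sx x0; elim/poly_ind: Q => [|Q c IHQ]; first by rewrite eqxx.
rewrite rmorphD rmorphM /= map_polyX map_polyC /root !hornerE /=.
have [->|c0] := eqVneq c 0.
  rewrite polyC0 addr0 mulr0z addr0 [(_).[_] * _ == 0]mulf_eq0 (negbTE x0) orbF.
  by move=> QX0; apply: IHQ; apply: contraNneq QX0 => ->; rewrite mul0r.
move=> _ /eqP E; exists c, (- (map_poly intr Q).[x]); last first.
  by split=> //; apply/eqP; rewrite mulrN mulrC -addr_eq0 addrC E.
rewrite rpredN rpred_horner //; apply/polyOverP => i.
by rewrite coef_map /= rpred_int.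
Qed.

Hypothesis fgS : fg_Zmodule S.

(** Multiplication by [p] acts on a generating family of [S] by an integer
    matrix, and the family is an eigenvector of it for the eigenvalue [p]; so
    [p] is a root of the (monic) characteristic polynomial. *)
Lemma fg_int_multiple p : p \in S -> p != 0 ->
  exists N : int, exists2 t, t \in S & N != 0 /\ N%:~R = p * t.
Proof.
move=> Sp p0; have [n [s sP]] := fgS.
have Ss (j : 'I_n) : s`_j \in S.
  apply/sP; exists [ffun i => (i == j)%:Z].
  rewrite (bigD1 j) //= ffunE eqxx mulr1z big1 ?addr0 // => i /negbTE ij.
  by rewrite ffunE ij mulr0z.
have /choice [a aP] (j : 'I_n) :
    exists a : {ffun 'I_n -> int}, p * s`_j = \sum_(i < n) s`_i *~ a i.
  by apply/sP; rewrite rpredM.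
pose A : 'M[int]_n := \matrix_(i, j) a j i.
pose u : 'rV[R]_n := \row_j s`_j.
have uA : u *m map_mx intr A = p *: u.
  apply/rowP => j; rewrite !mxE aP; apply: eq_bigr => i _.
  by rewrite !mxE mulrzr.
have u0 : u != 0.
  apply/negP => /eqP /rowP u0.
  have /sP [c /eqP] := rpred1 S.
  rewrite big1 ?oner_eq0 // => i _.
  by have := u0 i; rewrite !mxE => ->; rewrite mul0rz.
apply: (@int_multiple_of_root (char_poly A)) => //.
  exact/monic_neq0/char_poly_monic.
rewrite map_char_poly -eigenvalue_root_char.
by apply/eigenvalueP; exists u.
Qed.

(** A residue map of [S] modulo [p S], obtained by reducing modulo a nonzero
    integer [N] in [p S] the integer coordinates on a generating family. *)
Lemma fg_finite_residues p : p \in S -> p != 0 ->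
  exists (T : finType) (r : R -> T), forall x y,
    x \in S -> y \in S -> r x = r y -> exists2 t, t \in S & x - y = p * t.
Proof.
move=> Sp p0; have [N [t St [N0 Nt]]] := fg_int_multiple Sp p0.
have [n [s sP]] := fgS.
have /choice [z zP] x : exists z : {ffun 'I_n -> int},
    x \in S -> x = \sum_(i < n) s`_i *~ z i.
  have [/sP [z ->]|nSx] := boolP (x \in S); first by exists z.
  by exists [ffun=> 0].
(* The predecessor-successor makes the bound syntactically positive, as inord
   requires; it equals |N| because N is nonzero. *)
exists {ffun 'I_n -> 'I_`|N|.-1.+1},
  (fun x => [ffun i => inord `|(z x i %% N)%Z|%N]) => x y Sx Sy E.
have zN i : exists q, z x i - z y i = q * N.
  apply/dvdzP; rewrite -eqz_mod_dvd; apply/eqP.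
  have lt_mod w : (`|(w %% N)%Z| < `|N|.-1.+1)%N.
    rewrite prednK ?absz_gt0 // -ltz_nat.
    by rewrite gez0_abs ?modz_ge0 // ltz_mod.
  move: E => /ffunP/(_ i); rewrite !ffunE => /(congr1 val) /=.
  rewrite !inordK // => /(congr1 Posz).
  by rewrite !gez0_abs ?modz_ge0.
have /choice [q qP] := zN.
exists (t * \sum_(i < n) s`_i *~ q i).
  rewrite rpredM //; apply/sP; exists [ffun i => q i].
  by apply: eq_bigr => i _; rewrite ffunE.
rewrite {1}(zP x Sx) {1}(zP y Sy) -sumrB mulrA -Nt mulr_sumr.
apply: eq_bigr => i _.
by rewrite -mulrzBr qP mulrzA mulrzl.
Qed.

End FgSubring.

(** * Scaling factors of a lattice *)

Section Scal.
Variables (R : realType) (S : subringClosed R) (d : nat).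
Variable Gamma : free_lattice S d.
Implicit Types A B : Defs.orthogonal R d.

Lemma scaled_imageE a A :
  scaled_image Gamma a A = mulmx (a *: (A : 'M_d)) @` Gamma.
Proof. by apply: eq_imagel => v _; rewrite scalemxAl. Qed.

Lemma additive_subgroup_scaled_image a A :
  additive_subgroup (scaled_image Gamma a A).
Proof.
rewrite scaled_imageE.
exact/additive_subgroup_image/additive_subgroup_lattice.
Qed.

Lemma scaled_image_one : scaled_image Gamma 1 1%g = Gamma.
Proof.
rewrite scaled_imageE (_ : mulmx _ = id) ?image_id //.
by apply: funext => v; rewrite scale1r mul1mx.
Qed.

Lemma scaled_image_mul a A b B :
  mulmx (a *: (A : 'M_d)) @` scaled_image Gamma b B =
  scaled_image Gamma (a * b) (A * B)%g.
Proof.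
rewrite !scaled_imageE image_comp; apply: eq_imagel => v _ /=.
by rewrite mulmxA -scalemxAl -scalemxAr scalerA.
Qed.

Lemma commensurate_scaled_image a A b B c C : a != 0 ->
    commensurate (scaled_image Gamma b B) (scaled_image Gamma c C) ->
  commensurate (scaled_image Gamma (a * b) (A * B)%g)
               (scaled_image Gamma (a * c) (A * C)%g).
Proof.
move=> a0; rewrite -!scaled_image_mul.
apply: (@commensurate_image _ _ (mulmx (a^-1 *: (A : 'M_d)^T)));
  [|exact: additive_subgroup_scaled_image..].
move=> v; rewrite mulmxA -scalemxAl -scalemxAr scalerA mulVf //.
by rewrite ortho_mulTmx scale1r mul1mx.
Qed.

Lemma scalE a A : scal Gamma A a <->
  commensurate (scaled_image Gamma 1 1%g) (scaled_image Gamma a A).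
Proof. by rewrite scaled_image_one. Qed.

(** Apply [a A] to [G ~ b B G] and compare with [G ~ a A G]; [a] must be
    nonzero for [a A] to be invertible. *)
Lemma scal_mul a A b B : a != 0 ->
  scal Gamma A a -> scal Gamma B b -> scal Gamma (A * B)%g (a * b).
Proof.
move=> a0 /scalE ha /scalE hb; apply/scalE.
have sG := additive_subgroup_scaled_image.
apply: (commensurate_trans _ _ _ ha) => //.
by have := commensurate_scaled_image A a0 hb; rewrite mulr1 mulg1.
Qed.

Lemma scal_inv a A : a != 0 -> scal Gamma A a -> scal Gamma A^-1%g a^-1.
Proof.
move=> a0 /scalE ha; apply/scalE/commensurate_sym.
have a'0 : a^-1 != 0 by rewrite invr_eq0.
have := commensurate_scaled_image A^-1%g a'0 ha.
by rewrite mulr1 mulg1 mulVf // mulVg.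
Qed.

Lemma scal_OS A : OS Gamma A -> exists2 a, a != 0 & scal Gamma A a.
Proof.
move=> /asboolP [a a0 ha]; exists a; first by rewrite gt_eqF.
exact: commensurate_sym.
Qed.

Lemma OC_scal A : OC Gamma A <-> scal Gamma A 1.
Proof.
rewrite /OC /scal /= /scaled_image.
under [X in commensurate Gamma X]eq_imagel do rewrite scale1r.
by split=> /commensurate_sym.
Qed.

Lemma OC_OS A : OC Gamma A -> OS Gamma A.
Proof.
move=> /OC_scal hA; apply/asboolP; exists 1 => //.
exact: commensurate_sym.
Qed.

Section Homotheties.
Variables (b : d.-tuple 'cV[R]_d) (basb : basis_of fullv b).
Hypothesis GammaE : Gamma = [set \sum_(i < d) c i *: tnth b i | c in
  [set c : 'I_d -> R | forall i, c i \in S]] :> set _.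

Lemma mem_lattice v : lattice_set Gamma v <-> forall i, coord b i v \in S.
Proof.
rewrite GammaE; split=> [[c Sc <-] i|Sv].
  under eq_bigr do rewrite (tnth_nth 0).
  by rewrite coord_sum_free //; apply: basis_free basb.
exists (fun i => coord b i v) => //.
rewrite [RHS](coord_basis basb) ?memvf //.
by apply: eq_bigr => i _; rewrite (tnth_nth 0).
Qed.

Lemma mem_homothety a v : scaled_image Gamma a 1%g v ->
  forall i, exists2 c, c \in S & coord b i v = a * c.
Proof.
move=> [w /mem_lattice Gw <-] i; exists (coord b i w) => //.
by rewrite mul1mx linearZ.
Qed.

(** With [n b_0] in [a G], the coordinates give [n = a c] for some [c] in
    [S]. *)
Lemma scal_one_sub : (0 < d)%N -> scal Gamma 1%g `<=` frac_units S.
Proof.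
move=> d0 a [fin _].
pose i := Ordinal d0.
have sG := additive_subgroup_lattice Gamma.
have sI := additive_subgroupI sG (additive_subgroup_scaled_image a 1%g).
have ci (j k : 'I_d) : coord b j b`_k = (j == k)%:R.
  by rewrite coord_free 1?eq_sym //; apply: basis_free basb.
have Gi : lattice_set Gamma b`_i.
  by apply/mem_lattice => j; rewrite (ci j i) rpred_nat.
have [n n0 [_ /mem_homothety /(_ i) [c Sc]]] := finite_index_mulrn sG sI fin Gi.
rewrite linearMn /= (ci i i) eqxx => nE.
have /andP [a0 c0] : (a != 0) && (c != 0).
  by rewrite -negb_or -mulf_eq0 -nE pnatr_eq0 -lt0n.
split=> //; exists n%:R, c; split=> //; first exact: rpred_nat.
by rewrite nE mulfK.
Qed.

(** Residues modulo [p] of the coordinates separate the cosets of [p G]. *)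
Lemma scal_one_int p : fg_Zmodule S -> p \in S -> p != 0 ->
  scal Gamma 1%g p.
Proof.
move=> fgS Sp p0; have [T [r rP]] := fg_finite_residues fgS Sp p0.
have sG := additive_subgroup_lattice Gamma.
have sp := additive_subgroup_scaled_image p 1%g.
have sub : scaled_image Gamma p 1%g `<=` Gamma.
  move=> v /mem_homothety hv; apply/mem_lattice => i.
  by have [c Sc ->] := hv i; rewrite rpredM.
rewrite /scal /= /commensurate (setIidr sub); split.
  apply: (@finite_index_residues _ _ _ {ffun 'I_d -> T}
    (fun v => [ffun i => r (coord b i v)])) => // v w /mem_lattice Gv
    /mem_lattice Gw E.
  have /choice [t tP] i : exists t, t \in S /\ coord b i (v - w) = p * t.
    move: E => /ffunP/(_ i); rewrite !ffunE => /(rP _ _ (Gv i) (Gw i)) [t St tE].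
    by exists t; rewrite linearB.
  exists (\sum_i t i *: b`_i).
    apply/mem_lattice => i; rewrite coord_sum_free ?(tP i).1 //.
    exact: basis_free basb.
  rewrite mul1mx [RHS](coord_basis basb) ?memvf // scaler_sumr.
  by apply: eq_bigr => i _; rewrite scalerA -(tP i).2.
apply: (@finite_index_residues _ _ _ unit (fun=> tt)) => // v w pv pw _.
exact: sp.2.
Qed.

End Homotheties.

Lemma scal_one : fg_Zmodule S -> (0 < d)%N ->
  scal Gamma 1%g = frac_units S.
Proof.
move=> fgS d0; have [b basb GammaE] := free_latticeP Gamma.
apply/seteqP; split; first exact: scal_one_sub basb GammaE d0.
move=> _ [[p [q [Sp Sq q0 ->]]] pq0].
have p0 : p != 0 by apply: contraNneq pq0 => ->; rewrite mul0r.
rewrite -[X in scal _ X](mulgV 1%g); apply: scal_mul => //.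
  exact: scal_one_int basb GammaE _ fgS Sp p0.
by apply: scal_inv => //; apply: scal_one_int basb GammaE _ fgS Sq q0.
Qed.

(** If [a] and [c] are both admissible for [A], then [a^-1 c] is admissible for
    [A^-1 A = 1]. *)
Lemma scal_coset A a : fg_Zmodule S -> (0 < d)%N -> a != 0 ->
  scal Gamma A a -> scal Gamma A = [set a * k | k in frac_units S].
Proof.
move=> fgS d0 a0 ha; rewrite -scal_one //; apply/seteqP; split=> [c hc|].
  exists (a^-1 * c); last by rewrite mulrA mulfV ?mul1r.
  have a'0 : a^-1 != 0 by rewrite invr_eq0.
  by have := scal_mul a'0 (scal_inv a0 ha) hc; rewrite mulVg.
by move=> _ [k hk <-]; have := scal_mul a0 ha hk; rewrite mulg1.
Qed.

End Scal.

(** * The homomorphism *)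

Theorem lemma3p12 (R : realType) (S : subringClosed R) (fgS : fg_Zmodule S)
    (d : nat) (d_gt0 : (0 < d)%N) (Gamma : free_lattice S d) :
  exists eta : {multiplicative OSgroup Gamma -> units_quotient S},
    (forall A : OSgroup Gamma, eta A = scal Gamma A :> set R) /\
    [set OS_val A | A in [set A | eta A = 1%g]] = OC Gamma.
Proof.
have cosetP (A : OSgroup Gamma) :
    exists2 a, a != 0 & scal Gamma A = [set a * k | k in frac_units S].
  have [a a0 ha] := scal_OS (valP A).
  by exists a => //; apply: scal_coset.
pose eta A : units_quotient S := UnitsQuotient (cosetP A).
have etaM : {morph eta : A B / (A * B)%g}.
  move=> A B; apply: uquot_inj => /=.
  have [a a0 ha] := scal_OS (valP A); have [b b0 hb] := scal_OS (valP B).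
  have ab0 : a * b != 0 by apply: mulf_neq0.
  have hab : scal Gamma (A * B)%g (a * b) by apply: scal_mul.
  have k1 := frac_units1 S.
  rewrite (scal_coset fgS d_gt0 ab0 hab) (scal_coset fgS d_gt0 a0 ha).
  rewrite (scal_coset fgS d_gt0 b0 hb); apply/seteqP; split.
    move=> _ [k Kk <-]; exists (a * k); first by exists k.
    by exists b; [exists 1; rewrite ?mulr1 | rewrite mulrAC].
  move=> _ [_ [k Kk <-] [_ [l Kl <-] <-]].
  by exists (k * l); [apply: frac_unitsM | rewrite mulrACA].
pose etaMor := isMultiplicative.Build _ _ eta etaM.
pose etaF : {multiplicative OSgroup Gamma -> units_quotient S} :=
  HB.pack eta etaMor.
exists etaF; split=> //; apply/seteqP; split=> [_ [A /= etaA <-]|A OCA].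
  apply/OC_scal; have := frac_units1 S.
  by have /= <- := congr1 (@coset_set _ _) etaA.
have hA : scal Gamma A 1 by apply/OC_scal.
exists (MkOS (OC_OS OCA)) => //=; apply: uquot_inj => /=.
rewrite (scal_coset fgS d_gt0 (oner_neq0 R) hA).
by under eq_imagel do rewrite mul1r; rewrite image_id.
Qed.
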